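(* Let $q$ be a prime power, $s(x)=x^q+x$, $m$ a positive integer, and $g(y)=y^m+\sum_{i=2}^{m-1}a_iy^i$ with $a_i\in\mathbb{F}_q$. If $L(x)$ is a linearized polynomial over $\mathbb{F}_{q^2}$ of rank $2$ such that $L(\ker s)\subseteq\mathbb{F}_q$, then $f(x)=g(s(x))+L(x)$ is a permutation polynomial of $\mathbb{F}_{q^2}$.
   Context: A linearized polynomial over $\mathbb{F}_{q^2}$ is $L(x)=\alpha_1x^q+\alpha_0x$ with $\alpha_0,\alpha_1\in\mathbb{F}_{q^2}$; its rank and kernel are those of the $\mathbb{F}_q$-linear evaluation map on the $2$-dimensional $\mathbb{F}_q$-space $\mathbb{F}_{q^2}$. A permutation polynomial of $\mathbb{F}_{q^2}$ is one whose evaluation map is a bijection. *)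

(* Defs.v *)
From HB Require Import structures.
From mathcomp Require Import all_boot all_order all_fingroup all_algebra.
From mathcomp Require Import all_solvable all_field.

Set Implicit Arguments.
Unset Strict Implicit.
Unset Printing Implicit Defensive.

Import GRing.Theory.
Local Open Scope ring_scope.

(* The pair F_q < F_{q^2} is a finite field F with q elements together with an
   extension K : fieldExtType F of dimension 2; as a subset of K, F_q is the
   subspace 1%VS. *)

Definition prime_power (q : nat) : Prop :=
  exists p k : nat, [/\ prime p, (0 < k)%N & q = (p ^ k)%N].

Definition trace_poly (K : nzRingType) (q : nat) : {poly K} := 'X^q + 'X.

Definition linearized (K : nzRingType) (q : nat) (L : {poly K}) : Prop :=
  exists a1 a0 : K, L = a1 *: 'X^q + a0 *: 'X.

(* The evaluation map of P as an F-linear endomorphism of K. Only meaningful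
   when P evaluates linearly, since linfun returns an arbitrary map otherwise;
   evalmapE below covers linearized polynomials. *)
Definition evalmap (F : fieldType) (K : fieldExtType F) (P : {poly K}) :
  'End(K) := linfun (fun x : K => P.[x]).

Definition lin_rank (F : fieldType) (K : fieldExtType F) (P : {poly K}) : nat :=
  \dim (limg (evalmap P)).

Definition lin_ker (F : fieldType) (K : fieldExtType F) (P : {poly K}) :
  {vspace K} := lker (evalmap P).

Definition permutation_poly (K : nzRingType) (P : {poly K}) : Prop :=
  bijective (fun x : K => P.[x]).

Section EvalMap.
Variables (F : finFieldType) (K : fieldExtType F) (q : nat).
Hypotheses (q_pp : prime_power q) (cardF : #|F| = q).

Lemma trace_poly_linearized : linearized q (trace_poly K q).
Proof. by exists 1, 1; rewrite !scale1r. Qed.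

Lemma evalmapE (L : {poly K}) (x : K) :
  linearized q L -> evalmap L x = L.[x].
Proof.
case=> a1 [a0 ->].
have [p [k [p_pr _ qE]]] := q_pp.
have chF : p \in [pchar F] by apply: (@card_finPcharP F p k); rewrite ?cardF.
have chK : p \in [pchar K] by rewrite -(fmorph_pchar (in_alg K)) in chF.
have q_nat : [pchar K].-nat q.
  by rewrite qE pnatX; apply/orP; left; rewrite pnatE.
pose f (y : K) := a1 * y ^+ q + a0 * y.
have f_lin : linear f.
  move=> c u v; rewrite /f exprDn_pchar // exprZn -cardF expf_card.
  by rewrite !mulrDr -!scalerAr scalerDr addrACA.
pose fM := GRing.isLinear.Build F K K *:%R f f_lin.
pose fL : {linear K -> K} := HB.pack f fM.
have hE y : (a1 *: 'X^q + a0 *: 'X).[y] = fL y by rewrite !hornerE.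
rewrite /evalmap hE -(lfunE fL x); congr (fun_of_lfun _ x).
rewrite unlock; congr Hom.
by apply/matrixP=> i j; rewrite !mxE /= hE.
Qed.

End EvalMap.

(* Main.v *)
Require Import Defs.
From mathcomp Require Import all_boot all_order all_fingroup all_algebra.
From mathcomp Require Import all_solvable all_field.

Import GRing.Theory.
Local Open Scope ring_scope.

(** The trace polynomial s is F_q-linear with values in F_q, so its kernel has
    dimension at least 1. As L is injective, L (ker s) is a subspace of F_q of
    dimension at least 1, hence equals F_q. If f x = f y, then
    L (x - y) = g (s y) - g (s x) lies in F_q = L (ker s), so x - y lies in
    ker s; then s x = s y, thus L x = L y and x = y. *)

(** [finvect_type K] makes [K] a finite type, and an injective self-map of a finite set is
    bijective. *)
Lemma injective_permutation_poly (F : finFieldType) (K : fieldExtType F)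
    (P : {poly K}) :
  injective (fun x : K => P.[x]) -> permutation_poly P.
Proof. exact: (@injF_bij (finvect_type K)). Qed.

Section QuadraticExtension.
Variables (F : finFieldType) (K : fieldExtType F) (q : nat).
Hypotheses (q_pp : prime_power q) (cardF : #|F| = q).
Hypothesis dimK : \dim {:K} = 2%N.

(** F_q is the fixed set of the Frobenius map y -> y^q, which swaps the two summands of x^q + x
    because x^(q^2) = x. *)
Lemma trace_poly_in_base (x : K) : (trace_poly K q).[x] \in (1%VS : {vspace K}).
Proof.
have xqq : x ^+ q ^+ q = x.
  have := memvf x; rewrite Fermat's_little_theorem dimK cardF => /eqP.
  by rewrite -exprM.
(* Viewing y -> y^q as an [evalmap] provides its additivity. *)
have Xq_lin : linearized q ('X^q : {poly K}).
  by exists 1, 0; rewrite scale1r scale0r addr0.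
have frobE (y : K) : y ^+ q = evalmap 'X^q y.
  by rewrite (evalmapE q_pp cardF) // hornerXn.
rewrite Fermat's_little_theorem dimv1 expn1 cardF /trace_poly !hornerE.
by rewrite frobE raddfD /= -!frobE xqq addrC.
Qed.

Lemma dim_ker_trace_poly_gt0 : (0 < \dim (lin_ker (trace_poly K q)))%N.
Proof.
have img_le : (\dim (limg (evalmap (trace_poly K q))) <= 1)%N.
  have <- : \dim (1%VS : {vspace K}) = 1%N := dimv1 K.
  apply/dimvS/subvP=> _ /memv_imgP[x _ ->].
  rewrite (evalmapE q_pp cardF) ?trace_poly_in_base //.
  exact: trace_poly_linearized.
(* By rank-nullity, a zero kernel would force an image of dimension 2. *)
have := limg_ker_dim (evalmap (trace_poly K q)) fullv.
rewrite capfv dimK -/(lin_ker _); case: (\dim (lin_ker _)) => // img2.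
by rewrite add0n in img2; rewrite img2 in img_le.
Qed.

End QuadraticExtension.

Theorem theorem6 (q : nat) (hq : prime_power q)
    (F : finFieldType) (hF : #|F| = q)
    (K : fieldExtType F) (hK : \dim (fullv : {vspace K}) = 2%N)
    (m : nat) (hm : (0 < m)%N) (a : nat -> F)
    (L : {poly K}) (hL : linearized q L) (hrank : lin_rank L = 2%N)
    (hker : forall x : K, x \in lin_ker (trace_poly K q) ->
              L.[x] \in (1%VS : {vspace K})) :
  let g : {poly F} := 'X^m + \sum_(2 <= i < m) a i *: 'X^i in
  let s : {poly K} := trace_poly K q in
  permutation_poly (map_poly (in_alg K) g \Po s + L).
Proof.
move=> g s; apply: injective_permutation_poly.
have LE y : L.[y] = evalmap L y by rewrite (evalmapE hq hF).
have sE y : s.[y] = evalmap s y.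
  by rewrite (evalmapE hq hF) //; apply: trace_poly_linearized.
(* The rank equals \dim K = 2, so rank-nullity leaves dimension 0 for the kernel. *)
have kerL : lker (evalmap L) = 0%VS.
  have := limg_ker_dim (evalmap L) fullv.
  rewrite capfv hK -/(lin_rank L) hrank => /eqP.
  by rewrite -[X in _ == X]add0n eqn_add2r dimv_eq0 => /eqP.
have L_inj : injective (evalmap L) by apply/lker0P/eqP.
have imgE : (evalmap L @: lin_ker s)%VS = 1%VS.
  apply/eqP; rewrite eqEdim limg_dim_eq ?kerL ?capv0 // dimv1.
  rewrite (dim_ker_trace_poly_gt0 _ _ _ hq hF hK) andbT.
  by apply/subvP=> _ /memv_imgP[z z_ker ->]; rewrite -LE hker.
(* Since s(z) is the image of some c in F and g has coefficients in F, the value g(s(z)) is the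
   image of g(c). *)
have gs_base z : (map_poly (in_alg K) g).[s.[z]] \in (1%VS : {vspace K}).
  have /vlineP[c ->] := trace_poly_in_base _ _ _ hq hF hK z.
  by rewrite -[c%:A]/(in_alg K c) horner_map /= memvZ ?mem1v.
move=> x y /=; rewrite !hornerD !horner_comp => fxy.
have : evalmap L (x - y) \in (evalmap L @: lin_ker s)%VS.
  rewrite imgE raddfB /= -!LE.
  have -> : L.[x] - L.[y] = (map_poly (in_alg K) g).[s.[y]]
                          - (map_poly (in_alg K) g).[s.[x]].
    by apply/eqP; rewrite subr_eq addrAC -fxy addrAC subrr add0r.
  exact: rpredB.
(* Here L(x - y) = L(z) with z in ker s, and injectivity of L identifies x - y with z. *)
case/memv_imgP=> z z_ker /L_inj xyz; move: z_ker.
rewrite -xyz memv_ker raddfB subr_eq0 /= -!sE => /eqP sxy.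
by move: fxy; rewrite sxy => /addrI; rewrite !LE => /L_inj.
Qed.
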